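(* Let $\mathfrak{v}:E\to\mathrm{PL}(N,\mathbb{Z})$ be a finite piecewise linear valuation. Let $\mathcal{E}$ be a toric vector bundle on a complete toric variety $X_\Sigma$ representing the equivalence class of toric vector bundles corresponding to $\mathfrak{v}$. Then: (a) The subspace arrangement $\mathcal{A}_{\mathfrak{v},S_\Sigma}$ coincides with the Klyachko arrangement, obtained by taking intersections of all subspaces $E^\rho_i$ ($\rho\in\Sigma(1)$, $i\in\mathbb{Z}$) appearing in the Klyachko filtrations of $\mathcal{E}$. (b) The (Di Rocco–Jabbusch–Smith) parliament of polytopes $P(\mathcal{E})$ coincides with the parliament of polytopes $P(\mathfrak{v},S_\Sigma)$.
   Context: Setting. $\mathbf{k}$ is a field of characteristic $0$; $E$ is a finite dimensional $\mathbf{k}$-vector space; $T\cong(\mathbf{k}^* )^n$ is a split algebraic torus with character lattice $M$ and cocharacter lattice $N$, dual pairing $\langle\cdot,\cdot\rangle$, $M_\mathbb{R}=M\otimes\mathbb{R}$, $N_\mathbb{R}=N\otimes\mathbb{R}$. $\Sigma$ is a complete (finite, rational, polyhedral, strictly convex) fan in $N_\mathbb{R}$, $X_\Sigma$ its toric variety, $U_\sigma$ the chart of $\sigma\in\Sigma$, $\mathbf{v}_\rho$ the primitive generator of a ray $\rho\in\Sigma(1)$, $x_0$ a fixed point of the open torus orbit. $\mathrm{PL}(N,\mathbb{Z})$ is the set of functions $N_\mathbb{R}\to\mathbb{R}$ linear on each cone of some complete fan and integer valued on $N$, together with $\infty$ (constant function infinity), ordered pointwise. A finite piecewise linear valuation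 is a map $\mathfrak{v}:E\to\mathrm{PL}(N,\mathbb{Z})$ with $\mathfrak{v}(ce)=\mathfrak{v}(e)$ for $0\ne c\in\mathbf{k}$, $\mathfrak{v}(e_1+e_2)\ge\min(\mathfrak{v}(e_1),\mathfrak{v}(e_2))$, $\mathfrak{v}(e)=\infty$ iff $e=0$, and finite image. Toric vector bundles. A toric vector bundle is a vector bundle on $X_\Sigma$ with a $T$-linearization; here $\mathcal{E}_{x_0}=E$. $T$ acts on sections by $(t\cdot s)(x)=t\cdot s(t^{-1}x)$; the Klyachko filtrations are $(E^\rho_i)_{i\in\mathbb{Z}}$, where $E^\rho_i\subset E$ is the image under evaluation at $x_0$ of the weight space $\Gamma(U_\rho,\mathcal{E})_u$ for any $u\in M$ with $\langle u,\mathbf{v}_\rho\rangle=i$. For every $\sigma\in\Sigma$ there are a decomposition $E=\bigoplus_jL_{\sigma,j}$ into lines and $u_{\sigma,j}\in M$ with $E^\rho_i=\bigoplus_{\langle u_{\sigma,j},\mathbf{v}_\rho\rangle\ge i}L_{\sigma,j}$ for all rays $\rho$ of $\sigma$ and all $i$. That $\mathcal{E}$ represents the class corresponding to $\mathfrak{v}$ means: for all $\sigma\in\Sigma$, $x\in\sigma$, $0\ne e=\sum_je_j$ ($e_j\in L_{\sigma,j}$), $\mathfrak{v}(e)(x)=\min\{\langle x,u_{\sigma,j}\rangle\mid e_j\ne0\}$. The set $S_\Sigma$. Let $\widehat{\mathrm{PL}}(N,\overline{\mathbb{Z}})$ be the lattice (pointwise order, min, max) of functions $\phi:N\to\mathbb{Z}\cup\{\pm\infty\}$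 that are homogeneous of degree $1$, i.e. $\phi(cx)=c\,\phi(x)$ for all positive integers $c$ and $x\in N$; by restriction to $N$ it contains $\mathrm{PL}(N,\mathbb{Z})$. For $\rho\in\Sigma(1)$, $i\in\mathbb{Z}$, let $\phi_{\rho,i}\in\widehat{\mathrm{PL}}(N,\overline{\mathbb{Z}})$ be the function with $\phi_{\rho,i}(c\,\mathbf{v}_\rho)=c\,i$ for integers $c\ge0$ and $\phi_{\rho,i}(x)=-\infty$ for $x\in N\setminus\rho$. $S_\Sigma$ is the set of all maxima of nonempty finite collections of the functions $\phi_{\rho,i}$. Arrangements and matroids. For $S\subset\widehat{\mathrm{PL}}(N,\overline{\mathbb{Z}})$ closed under maximum, $\mathcal{A}_{\mathfrak{v},S}=\{E_{\ge\phi}\mid\phi\in S\}$ with $E_{\ge\phi}=\{e\in E\mid\mathfrak{v}(e)(x)\ge\phi(x)\ \forall x\in N\}$. For a finite arrangement $\mathcal{A}$ of subspaces of $E$ closed under intersection, let $U_1,\dots,U_m$ be the subspaces in $\mathcal{A}$ that are not sums of other subspaces in $\mathcal{A}$, pick a basis $B_i$ of each $U_i$, put $\mathcal{B}=\bigcup_iB_i$; $\mathcal{B}$ is generic if for all $B_0\subset\mathcal{B}$ and $e_i\in B_i\setminus B_0$: $e_i\in\operatorname{span}(B_0)$ iff $U_i\subset\operatorname{span}(B_0)$. The matroid of $\mathcal{A}$ is the linear matroid on a generic $\mathcal{B}$. $M(\mathfrak{v},S)$ is the matroid (and its ground set) of $\mathcal{A}_{\mathfrak{v},S}$, and $M(\mathcal{E})$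 is the matroid (and its ground set) of the Klyachko arrangement; when comparing parliaments, the same generic set is used for the same arrangement. Parliaments. For $\phi\in\mathrm{PL}(N,\mathbb{Z})$, $P_\phi=\{y\in M_\mathbb{R}\mid\langle x,y\rangle\le\phi(x)\ \forall x\in N_\mathbb{R}\}$, and $P(\mathfrak{v},S)$ is the multiset $\{P_{\mathfrak{v}(e)}\mid e\in M(\mathfrak{v},S)\}$. The Di Rocco–Jabbusch–Smith parliament $P(\mathcal{E})$ is the multiset $\{P_e\mid e\in M(\mathcal{E})\}$ with $P_e=\{y\in M_\mathbb{R}\mid\langle y,\mathbf{v}_\rho\rangle\le\max\{i\mid e\in E^\rho_i\}\ \forall\rho\in\Sigma(1)\}$. *)

(* Defs.v *)
From mathcomp Require Import all_boot all_order all_algebra.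
From mathcomp Require Import boolp classical_sets functions cardinality fsbigop.
From mathcomp Require Import constructive_ereal reals ereal.

Set Implicit Arguments.
Unset Strict Implicit.
Unset Printing Implicit Defensive.

Import Order.TTheory GRing.Theory Num.Theory.

Local Open Scope classical_set_scope.
Local Open Scope ring_scope.

(* Coordinates are fixed on the torus, so that N = M = Z^n is 'rV[int]_n and
   N_R = M_R = R^n is 'rV[R]_n; a lattice point is viewed in R^n via toR. *)

Definition pairing (A : comNzRingType) (n : nat) (x u : 'rV[A]_n) : A :=
  \sum_i x 0 i * u 0 i.

Definition toR (R : realType) (n : nat) (x : 'rV[int]_n) : 'rV[R]_n :=
  map_mx intr x.

(** * Cones and fans *)

Definition cone_gen (R : realType) (n : nat) (s : seq 'rV[int]_n) :
    set 'rV[R]_n :=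
  [set x | exists c : 'I_(size s) -> R,
     (forall i, 0 <= c i) /\ x = \sum_i c i *: toR R s`_i].
Arguments cone_gen R {n} s.

Definition rational_polyhedral (R : realType) (n : nat)
    (sigma : set 'rV[R]_n) : Prop :=
  exists s : seq 'rV[int]_n, sigma = cone_gen R s.

Definition strictly_convex (R : realType) (n : nat)
    (sigma : set 'rV[R]_n) : Prop :=
  forall x, sigma x -> sigma (- x) -> x = 0.

Definition face (R : realType) (n : nat) (tau sigma : set 'rV[R]_n) : Prop :=
  exists u : 'rV[R]_n, (forall x, sigma x -> 0 <= pairing x u) /\
    tau = [set x | sigma x /\ pairing x u = 0].

Definition complete_fan (R : realType) (n : nat)
    (Sigma : set (set 'rV[R]_n)) : Prop :=
  [/\ finite_set Sigma,
      (forall sigma, Sigma sigma ->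
         rational_polyhedral sigma /\ strictly_convex sigma),
      (forall sigma tau, Sigma sigma -> face tau sigma -> Sigma tau),
      (forall sigma tau, Sigma sigma -> Sigma tau ->
         face (sigma `&` tau) sigma /\ face (sigma `&` tau) tau)
    & (forall x, exists2 sigma, Sigma sigma & sigma x)].

Definition primitive (n : nat) (v : 'rV[int]_n) : Prop :=
  v != 0 /\ forall (c : nat) (w : 'rV[int]_n), v = w *+ c -> c = 1%N.

Definition ray (R : realType) (n : nat) (v : 'rV[int]_n) : set 'rV[R]_n :=
  cone_gen R [:: v].
Arguments ray R {n} v.

(* Sigma(1), each ray rho being represented by its primitive generator v_rho *)
Definition rays (R : realType) (n : nat) (Sigma : set (set 'rV[R]_n)) :
    set 'rV[int]_n :=
  [set v | primitive v /\ Sigma (ray R v)].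

(** * Piecewise linear functions and valuations *)

(* PL(N, Z); the constant function +oo is the element "infinity" *)
Definition PL (R : realType) (n : nat) : set ('rV[R]_n -> \bar R) :=
  [set phi | phi = cst +oo%E \/
    exists f : 'rV[R]_n -> R,
      [/\ phi = (fun x => (f x)%:E),
          (exists2 Delta, complete_fan Delta &
             forall sigma, Delta sigma ->
               exists u : 'rV[R]_n, forall x, sigma x -> f x = pairing x u)
        & (forall x : 'rV[int]_n, exists z : int, f (toR R x) = z%:~R)]].
Arguments PL R n : clear implicits.

Definition finite_PL_valuation (k : fieldType) (E : vectType k)
    (R : realType) (n : nat) (v : E -> 'rV[R]_n -> \bar R) : Prop :=
  [/\ (forall e, PL R n (v e)),
      (forall (c : k) e, c != 0 -> v (c *: e) = v e),
      (forall e1 e2 x, (Order.min (v e1 x) (v e2 x) <= v (e1 + e2)%R x)%E),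
      (forall e, v e = cst +oo%E <-> e = 0)
    & finite_set (range v)].

Definition hatPL (n : nat) : set ('rV[int]_n -> \bar int) :=
  [set phi | forall (c : nat) (x : 'rV[int]_n), (0 < c)%N ->
     phi (x *+ c) = ((c%:Z)%:E * phi x)%E].

(* phi_{rho,i}, where v = v_rho; as v is primitive, the lattice points of the
   ray are the c * v for c in nat, and c is determined by c * v *)
Definition phi_ray (n : nat) (v : 'rV[int]_n) (i : int) (x : 'rV[int]_n) :
    \bar int :=
  match pselect (exists c : nat, x = v *+ c) with
  | left h => ((projT1 (cid h))%:Z * i)%:E
  | right _ => -oo%E
  end.

(* F lists the pairs (v_rho, i) *)
Definition phi_max (n : nat) (F : seq ('rV[int]_n * int)) (x : 'rV[int]_n) :
    \bar int :=
  \big[Order.max/-oo%E]_(p <- F) phi_ray p.1 p.2 x.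

Definition S_fan (R : realType) (n : nat) (Sigma : set (set 'rV[R]_n)) :
    set ('rV[int]_n -> \bar int) :=
  [set phi | exists F : seq ('rV[int]_n * int),
     [/\ F != [::], (forall p, p \in F -> rays Sigma p.1)
       & phi = phi_max F]].

(* phi_ray has the defining properties of phi_{rho,i}, and S_fan is a subset
   of hatPL closed under maximum. *)

Lemma mulrn_inj_rV (n : nat) (v : 'rV[int]_n) (c d : nat) :
  v != 0 -> v *+ c = v *+ d -> c = d.
Proof.
move=> v0 /rowP E; have /rV0Pn [j vj] := v0.
by move: (E j); rewrite !mulmxnE => /(mulrIn vj).
Qed.

Lemma phi_rayE (n : nat) (v : 'rV[int]_n) (i : int) (c : nat) :
  v != 0 -> phi_ray v i (v *+ c) = (c%:Z * i)%:E.
Proof.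
move=> v0; rewrite /phi_ray; case: pselect => [h|]; last by case; exists c.
by case: (cid h) => d /= /(mulrn_inj_rV v0) ->.
Qed.

Lemma primitive_div (n : nat) (v x : 'rV[int]_n) (c d : nat) :
  primitive v -> (0 < c)%N -> x *+ c = v *+ d -> exists e : nat, x = v *+ e.
Proof.
move=> [v0 vp] c0 E.
have g0 : (0 < gcdn c d)%N by rewrite gcdn_gt0 c0.
pose c' := (c %/ gcdn c d)%N; pose d' := (d %/ gcdn c d)%N.
have cE : c = (c' * gcdn c d)%N by rewrite divnK ?dvdn_gcdl.
have dE : d = (d' * gcdn c d)%N by rewrite divnK ?dvdn_gcdr.
have E' : x *+ c' = v *+ d'.
  apply/rowP => j; move/rowP/(_ j): E.
  rewrite {1}cE {2}dE !mulmxnE !mulrnA => /eqP.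
  by rewrite eqrMn2r (gtn_eqF g0) /= => /eqP.
have cop : coprimez c'%:Z d'%:Z.
  rewrite coprimezE /= /coprime.
  by rewrite -(eqn_pmul2r g0) muln_gcdl -cE -dE mul1n.
have dv (j : 'I_n) : (c'%:Z %| v ord0 j)%Z.
  rewrite -(Gauss_dvdzr _ cop).
  move/rowP/(_ j): E'; rewrite !mulmxnE !pmulrn !mulrzz => H.
  by rewrite [X in (_ %| X)%Z]mulrC -H dvdz_mull.
have c'1 : c' = 1%N.
  apply: (vp _ (\row_j (v ord0 j %/ c'%:Z)%Z)); apply/rowP => j.
  by rewrite mulmxnE mxE pmulrn mulrzz divzK.
by exists d'; rewrite -E' c'1.
Qed.

Lemma phi_ray_hatPL (n : nat) (v : 'rV[int]_n) (i : int) :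
  primitive v -> hatPL (phi_ray v i).
Proof.
move=> vp c x c0; have [v0 _] := vp.
have [[e ->]|nx] := pselect (exists e : nat, x = v *+ e).
  by rewrite -mulrnA !phi_rayE // -EFinM mulrA -PoszM mulnC.
rewrite {2}/phi_ray; case: pselect => // _.
rewrite mulrNy gtr0_sg ?mul1e // /phi_ray; case: pselect => // -[d xd].
by case: nx; apply: primitive_div xd.
Qed.

Lemma S_fan_hatPL (R : realType) (n : nat) (Sigma : set (set 'rV[R]_n)) :
  S_fan Sigma `<=` @hatPL n.
Proof.
move=> _ [F [_ Fr ->]] c x c0; rewrite /phi_max.
have cE : (0 <= (c%:Z)%:E :> \bar int)%E by rewrite lee_fin.
elim: F Fr => [_|p F IH Fr].
  by rewrite !big_nil mulrNy gtr0_sg ?mul1e.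
rewrite !big_cons IH; last by move=> q qF; apply: Fr; rewrite inE qF orbT.
rewrite phi_ray_hatPL //; last by have [] := Fr p (mem_head _ _).
by rewrite maxe_pMr.
Qed.

Lemma S_fan_max (R : realType) (n : nat) (Sigma : set (set 'rV[R]_n)) phi psi :
  S_fan Sigma phi -> S_fan Sigma psi ->
  S_fan Sigma (fun x => Order.max (phi x) (psi x)).
Proof.
move=> [F [F0 FS ->]] [G [_ GS ->]]; exists (F ++ G); split.
- by case: F F0 FS.
- by move=> p; rewrite mem_cat => /orP[/FS|/GS].
- by apply/funext => x; rewrite /phi_max big_cat.
Qed.

(** * Toric vector bundles *)

(* A point of T(k) = (k^* )^n is a row vector with nonzero entries. *)
Definition torus (k : fieldType) (n : nat) : set 'rV[k]_n :=
  [set t | forall i, t 0 i != 0].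

Definition torus_mul (k : fieldType) (n : nat) (s t : 'rV[k]_n) : 'rV[k]_n :=
  \row_i (s 0 i * t 0 i).

Definition character (k : fieldType) (n : nat) (u : 'rV[int]_n)
    (t : 'rV[k]_n) : k :=
  \prod_i t 0 i ^ u 0 i.

(* the semigroup sigma^vee \cap M; U_sigma is the spectrum of its algebra *)
Definition dual_monoid (R : realType) (n : nat) (sigma : set 'rV[R]_n) :
    set 'rV[int]_n :=
  [set m | forall x, sigma x -> 0 <= pairing x (toR R m)].

(* A k[U_sigma]-module is a k-vector space G with commuting linear operators
   chi^m, m in sigma^vee \cap M.  It is finitely generated projective (that
   is, the module of sections of a vector bundle on U_sigma) iff it has a
   finite dual basis: generators g_i and k[U_sigma]-linear coordinate forms
   G -> k[U_sigma].  Here coord i s m is the coefficient of chi^m in the i-th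
   coordinate of s. *)
Definition fg_projective (k : fieldType) (R : realType) (n : nat)
    (sigma : set 'rV[R]_n) (G : lmodType k)
    (mul : 'rV[int]_n -> {linear G -> G}) : Prop :=
  exists (r : nat) (g : 'I_r -> G) (coord : 'I_r -> G -> 'rV[int]_n -> k),
    [/\ (forall i (a : k) s s' m,
           coord i (a *: s + s') m = a * coord i s m + coord i s' m),
        (forall i s, finite_set [set m | coord i s m != 0] /\
           [set m | coord i s m != 0] `<=` dual_monoid sigma),
        (forall i s m w, dual_monoid sigma m ->
           coord i (mul m s) w = coord i s (w - m))
      & (forall s,
           s = \sum_(i < r) \sum_(m \in [set: 'rV[int]_n])
                 coord i s m *: mul m (g i))].

(* A toric vector bundle on X_Sigma whose fibre at x_0 is E, given by its
   sections over the affine charts: a vector bundle is a compatible family of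
   finitely generated projective modules over the rings k[U_sigma], and a
   T-linearization is the induced action of T on sections.  The fields are
   only meaningful for cones of Sigma and, for tvb_mul, for m in sigma^vee. *)
Record toric_vector_bundle (k : fieldType) (E : vectType k) (R : realType)
    (n : nat) (Sigma : set (set 'rV[R]_n)) := ToricVectorBundle {
  (* the sections over U_sigma *)
  tvb_sec : set 'rV[R]_n -> lmodType k;
  (* multiplication by the function chi^m *)
  tvb_mul : forall sigma, 'rV[int]_n -> {linear tvb_sec sigma -> tvb_sec sigma};
  (* (t . s)(x) = t . s(t^-1 x) *)
  tvb_act : forall sigma, 'rV[k]_n -> {linear tvb_sec sigma -> tvb_sec sigma};
  (* restriction from U_sigma to U_tau, for tau contained in sigma *)
  tvb_res : forall sigma tau, {linear tvb_sec sigma -> tvb_sec tau};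
  (* evaluation at x_0 of sections over the open orbit U_{0} *)
  tvb_ev0 : {linear tvb_sec [set 0] -> E};

  tvb_mul0 : forall sigma s, Sigma sigma -> tvb_mul sigma 0 s = s;
  tvb_mulD : forall sigma m m' s, Sigma sigma ->
    dual_monoid sigma m -> dual_monoid sigma m' ->
    tvb_mul sigma (m + m') s = tvb_mul sigma m (tvb_mul sigma m' s);
  tvb_proj : forall sigma, Sigma sigma -> fg_projective sigma (tvb_mul sigma);

  tvb_act1 : forall sigma s, Sigma sigma -> tvb_act sigma (const_mx 1) s = s;
  tvb_actM : forall sigma t t' s, Sigma sigma -> torus t -> torus t' ->
    tvb_act sigma (torus_mul t t') s = tvb_act sigma t (tvb_act sigma t' s);
  (* chi^m(t^-1 x) = chi^m(t)^-1 chi^m(x) *)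
  tvb_act_mul : forall sigma m t s, Sigma sigma -> dual_monoid sigma m ->
    torus t ->
    tvb_act sigma t (tvb_mul sigma m s) =
      (character m t)^-1 *: tvb_mul sigma m (tvb_act sigma t s);
  (* the action is algebraic: every section is a sum of weight vectors *)
  tvb_act_rational : forall sigma (s : tvb_sec sigma), Sigma sigma ->
    exists2 ss : seq (tvb_sec sigma),
      (forall s', s' \in ss -> exists u : 'rV[int]_n,
         forall t, torus t -> tvb_act sigma t s' = character u t *: s')
      & s = \sum_(s' <- ss) s';

  tvb_res_id : forall sigma s, Sigma sigma -> tvb_res sigma sigma s = s;
  tvb_res_comp : forall sigma tau gamma s,
    Sigma sigma -> Sigma tau -> Sigma gamma ->
    gamma `<=` tau -> tau `<=` sigma ->
    tvb_res tau gamma (tvb_res sigma tau s) = tvb_res sigma gamma s;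
  tvb_res_mul : forall sigma tau m s, Sigma sigma -> Sigma tau ->
    tau `<=` sigma -> dual_monoid sigma m ->
    tvb_res sigma tau (tvb_mul sigma m s) =
      tvb_mul tau m (tvb_res sigma tau s);
  tvb_res_act : forall sigma tau t s, Sigma sigma -> Sigma tau ->
    tau `<=` sigma -> torus t ->
    tvb_res sigma tau (tvb_act sigma t s) =
      tvb_act tau t (tvb_res sigma tau s);
  (* k[U_tau] is the localization of k[U_sigma] at the chi^m with m in
     sigma^vee and vanishing on tau; so are the modules of sections *)
  tvb_loc_surj : forall sigma tau (s : tvb_sec tau), Sigma sigma -> Sigma tau ->
    tau `<=` sigma ->
    exists m, [/\ dual_monoid sigma m,
      (forall x, tau x -> pairing x (toR R m) = 0)
      & exists s' : tvb_sec sigma, tvb_mul tau m s = tvb_res sigma tau s'];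
  tvb_loc_inj : forall sigma tau (s : tvb_sec sigma), Sigma sigma ->
    Sigma tau -> tau `<=` sigma -> tvb_res sigma tau s = 0 ->
    exists m, [/\ dual_monoid sigma m,
      (forall x, tau x -> pairing x (toR R m) = 0)
      & tvb_mul sigma m s = 0];

  (* E is the fibre at x_0, the point of the open orbit where all chi^m take
     the value 1: it is the quotient of the sections over U_{0} by the
     elements chi^m s - s *)
  tvb_ev0_surj : forall e, exists s, tvb_ev0 s = e;
  tvb_ev0_ker : forall s, tvb_ev0 s = 0 <->
    exists ms : seq ('rV[int]_n * tvb_sec [set 0]),
      s = \sum_(p <- ms) (tvb_mul [set 0] p.1 p.2 - p.2)
}.

Definition weight_space (k : fieldType) (E : vectType k) (R : realType)
    (n : nat) (Sigma : set (set 'rV[R]_n)) (B : toric_vector_bundle E Sigma)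
    (sigma : set 'rV[R]_n) (u : 'rV[int]_n) : set (tvb_sec B sigma) :=
  [set s | forall t, torus t -> tvb_act B sigma t s = character u t *: s].
Arguments weight_space {k E R n Sigma} B sigma u _.

Definition evaluation (k : fieldType) (E : vectType k) (R : realType)
    (n : nat) (Sigma : set (set 'rV[R]_n)) (B : toric_vector_bundle E Sigma)
    (sigma : set 'rV[R]_n) (s : tvb_sec B sigma) : E :=
  tvb_ev0 B (tvb_res B sigma [set 0] s).

(* E^rho_i, where v = v_rho; the image does not depend on the choice of u *)
Definition klyachko_filtration (k : fieldType) (E : vectType k)
    (R : realType) (n : nat) (Sigma : set (set 'rV[R]_n))
    (B : toric_vector_bundle E Sigma) (v : 'rV[int]_n) (i : int) : set E :=
  [set e | exists2 u : 'rV[int]_n, pairing v u = i &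
     exists2 s, weight_space B (ray R v) u s & evaluation s = e].

(* On each cone, the decomposition into lines L j with characters u j must
   induce both the Klyachko filtrations of B and the valuation v. *)
Definition represents (k : fieldType) (E : vectType k) (R : realType)
    (n : nat) (Sigma : set (set 'rV[R]_n)) (B : toric_vector_bundle E Sigma)
    (v : E -> 'rV[R]_n -> \bar R) : Prop :=
  forall sigma, Sigma sigma ->
  exists (r : nat) (L : 'I_r -> {vspace E}) (u : 'I_r -> 'rV[int]_n),
    [/\ (forall j, \dim (L j) = 1%N),
        directv (\sum_(j < r) L j)%VS /\ (\sum_(j < r) L j)%VS = fullv,
        (forall w i, rays Sigma w -> ray R w `<=` sigma ->
           klyachko_filtration B w i =
             [set` (\sum_(j < r | (i <= pairing w (u j))%R) L j)%VS])
      & (forall x (e : 'I_r -> E), sigma x -> (forall j, e j \in L j) ->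
           \sum_j e j != 0 ->
           v (\sum_j e j) x =
             \big[Order.min/+oo%E]_(j < r | e j != 0)
                (pairing x (toR R (u j)))%:E)].

(** * Arrangements and generic ground sets *)

Definition E_ge (k : fieldType) (E : vectType k) (R : realType) (n : nat)
    (v : E -> 'rV[R]_n -> \bar R) (phi : 'rV[int]_n -> \bar int) : set E :=
  [set e | forall x : 'rV[int]_n,
     (er_map (fun z : int => z%:~R : R) (phi x) <= v e (toR R x))%E].

Definition arrangement (k : fieldType) (E : vectType k) (R : realType)
    (n : nat) (v : E -> 'rV[R]_n -> \bar R)
    (S : set ('rV[int]_n -> \bar int)) : set {vspace E} :=
  [set U | exists2 phi, S phi & [set` U] = E_ge v phi].

(* intersections of nonempty finite collections of the E^rho_i *)
Definition klyachko_arrangement (k : fieldType) (E : vectType k)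
    (R : realType) (n : nat) (Sigma : set (set 'rV[R]_n))
    (B : toric_vector_bundle E Sigma) : set {vspace E} :=
  [set U | exists F : seq ('rV[int]_n * int),
     [/\ F != [::], (forall p, p \in F -> rays Sigma p.1)
       & [set` U] =
           [set e | forall p, p \in F -> klyachko_filtration B p.1 p.2 e]]].

(* the zero space is an (empty) sum, hence never indecomposable *)
Definition indecomposable (k : fieldType) (E : vectType k)
    (A : set {vspace E}) (U : {vspace E}) : Prop :=
  A U /\ ~ exists2 s : seq {vspace E},
             (forall W, W \in s -> A W /\ W <> U) & U = (\sum_(W <- s) W)%VS.

(* gens lists, without repetition, a generic union of bases b U of the
   indecomposable members U of A *)
Definition generic_ground_set (k : fieldType) (E : vectType k)
    (A : set {vspace E}) (gens : seq E) : Prop :=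
  uniq gens /\ exists b : {vspace E} -> seq E,
    [/\ (forall U, indecomposable A U -> basis_of U (b U)),
        (forall e, e \in gens <-> exists2 U, indecomposable A U & e \in b U)
      & (forall (B0 : seq E) U e, {subset B0 <= gens} ->
           indecomposable A U -> e \in b U -> e \notin B0 ->
           (e \in <<B0>>%VS <-> (U <= <<B0>>)%VS))].

(** * Parliaments of polytopes *)

(* Multisets are lists up to perm_eq.  The ground set of the matroid of an
   arrangement A is M A: as M depends on A only, equal arrangements get the
   same generic set. *)

Definition polytope (R : realType) (n : nat) (phi : 'rV[R]_n -> \bar R) :
    set 'rV[R]_n :=
  [set y | forall x, ((pairing x y)%:E <= phi x)%E].

Definition parliament (k : fieldType) (E : vectType k) (R : realType)
    (n : nat) (M : set {vspace E} -> seq E) (v : E -> 'rV[R]_n -> \bar R)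
    (S : set ('rV[int]_n -> \bar int)) : seq (set 'rV[R]_n) :=
  [seq polytope (v e) | e <- M (arrangement v S)].

(* max {i | e \in E^rho_i}, where w = v_rho, taken in the extended reals; the
   supremum is attained unless e = 0 *)
Definition klyachko_max (k : fieldType) (E : vectType k) (R : realType)
    (n : nat) (Sigma : set (set 'rV[R]_n)) (B : toric_vector_bundle E Sigma)
    (w : 'rV[int]_n) (e : E) : \bar R :=
  ereal_sup [set (i%:~R : R)%:E | i in [set i | klyachko_filtration B w i e]].

Definition DJS_polytope (k : fieldType) (E : vectType k) (R : realType)
    (n : nat) (Sigma : set (set 'rV[R]_n)) (B : toric_vector_bundle E Sigma)
    (e : E) : set 'rV[R]_n :=
  [set y | forall w, rays Sigma w ->
     ((pairing (toR R w) y)%:E <= klyachko_max B w e)%E].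

Definition DJS_parliament (k : fieldType) (E : vectType k) (R : realType)
    (n : nat) (M : set {vspace E} -> seq E) (Sigma : set (set 'rV[R]_n))
    (B : toric_vector_bundle E Sigma) : seq (set 'rV[R]_n) :=
  [seq DJS_polytope B e | e <- M (klyachko_arrangement B)].

(* Main.v *)
Require Import Defs.
From mathcomp Require Import all_boot all_order all_algebra.
From mathcomp Require Import boolp classical_sets functions cardinality fsbigop.
From mathcomp Require Import constructive_ereal reals ereal.

Set Implicit Arguments.
Unset Strict Implicit.
Unset Printing Implicit Defensive.

Import Order.TTheory GRing.Theory Num.Theory.
Local Open Scope classical_set_scope.
Local Open Scope ring_scope.

(** On a cone [sigma] the bundle splits into lines with characters [u j], and
    for a nonzero vector [e] both its value [v e] on [sigma] and its position in
    the Klyachko filtrations of the rays of [sigma] are read off from the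
    characters of the lines on which [e] has a nonzero component: the former is
    their minimum, the latter compares that minimum at the ray generator [w]
    with [i] ([local_characters]). Taking for [sigma] the ray itself, [e] lies
    in the [i]-th step of the filtration of [w] iff [i <= v e w]
    ([klyachko_filtrationP]).

    Arrangements: a maximum of functions [phi_ray w i] is below [v e] iff each of
    them is, and [phi_ray w i] is below [v e] iff [i <= v e w], by homogeneity
    along the ray. Hence the subspaces cut out by [S_fan] are exactly the finite
    intersections of filtration steps ([arrangement_S_fan]).

    Parliaments: the ground sets being equal, it remains to see that both
    polytopes attached to a nonzero [e] agree. The largest filtration index of
    [e] at [w] is [v e w] ([klyachko_maxE]), so the polytope of Di Rocco, Jabbusch
    and Smith imposes the inequalities [<x, y> <= v e x] at the ray generators
    only. They imply the inequality everywhere, as [v e] is concave on each cone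
    and each cone is generated by its rays ([DJS_polytopeE]).

    That a strictly convex cone is generated by rays that are faces of it
    ([fan_cone_rays]) rests on Gordan's alternative: finitely many vectors are
    positive under a common functional unless they have a nontrivial relation
    with nonnegative coefficients ([gordan]). *)

(** * The pairing *)

Section Pairing.
Variables (A : comNzRingType) (n : nat).
Implicit Types x y u a : 'rV[A]_n.

Lemma pairingC x u : pairing x u = pairing u x.
Proof. by apply: eq_bigr => i _; rewrite mulrC. Qed.

Lemma pairingDl x y u : pairing (x + y) u = pairing x u + pairing y u.
Proof. by rewrite -big_split; apply: eq_bigr => i _; rewrite mxE mulrDl. Qed.

Lemma pairingZl (c : A) x u : pairing (c *: x) u = c * pairing x u.
Proof. by rewrite mulr_sumr; apply: eq_bigr => i _; rewrite mxE mulrA. Qed.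

Lemma pairingDr x u y : pairing x (u + y) = pairing x u + pairing x y.
Proof. by rewrite pairingC pairingDl -!(pairingC x). Qed.

Lemma pairingZr (c : A) x u : pairing x (c *: u) = c * pairing x u.
Proof. by rewrite pairingC pairingZl pairingC. Qed.

Lemma pairing0l u : pairing 0 u = 0.
Proof. by rewrite -(scale0r 0) pairingZl mul0r. Qed.

Lemma pairing_suml (I : Type) (r : seq I) (P : pred I) (F : I -> 'rV[A]_n) u :
  pairing (\sum_(i <- r | P i) F i) u = \sum_(i <- r | P i) pairing (F i) u.
Proof.
apply: (big_morph (fun x => pairing x u)) => [x y|]; first exact: pairingDl.
exact: pairing0l.
Qed.

(** The multiple by [<a, a>] of the orthogonal projection along [a]; clearing
    the denominator keeps it defined when [a = 0]. *)
Definition proj_along a x := pairing a a *: x - pairing x a *: a.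

Lemma pairing_proj_along a x u :
  pairing (proj_along a x) u = pairing x (proj_along a u).
Proof.
rewrite /proj_along -!scaleNr pairingDl pairingDr !pairingZl !pairingZr.
by rewrite (pairingC u a) !mulNr [X in _ - X]mulrC.
Qed.

Lemma proj_along_orth a u : pairing a (proj_along a u) = 0.
Proof.
rewrite /proj_along -scaleNr pairingDr !pairingZr (pairingC u a).
by rewrite mulNr mulrC subrr.
Qed.

End Pairing.

Lemma pairing_gt0 (R : realDomainType) (n : nat) (a : 'rV[R]_n) :
  a != 0 -> 0 < pairing a a.
Proof.
move=> /rV0Pn [j aj]; rewrite /pairing (bigD1 j) //= ltr_wpDr //.
  by apply: sumr_ge0 => i _; rewrite -expr2 sqr_ge0.
by rewrite -expr2 exprn_even_gt0.
Qed.

Lemma toRMn (R : realType) (n : nat) (w : 'rV[int]_n) (c : nat) :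
  toR R (w *+ c) = c%:R *: toR R w.
Proof. by apply/rowP => j; rewrite !mxE mulmxnE rmorphMn mulr_natl. Qed.

Lemma pairing_toR (R : realType) (n : nat) (w u : 'rV[int]_n) :
  pairing (toR R w) (toR R u) = (pairing w u)%:~R.
Proof.
by rewrite /pairing rmorph_sum; apply: eq_bigr => i _; rewrite !mxE rmorphM.
Qed.

(** * Gordan's alternative *)

Section Gordan.
Variables (R : realFieldType) (n : nat) (I : finType).
Implicit Types (b : I -> 'rV[R]_n) (A : {set I}).

Definition strictly_positive b A (u : 'rV[R]_n) :=
  forall i, i \in A -> 0 < pairing (b i) u.

Definition semipositive A (c : I -> R) :=
  (forall i, 0 <= c i) /\ exists2 i, i \in A & 0 < c i.

(** Projecting along [a] turns Gordan's alternative into its version relative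
    to the line of [a]: projection is self-adjoint, so a functional positive on
    the projected vectors may be taken orthogonal to [a]. *)
Lemma gordan_relative b A (a : 'rV[R]_n) : a != 0 ->
  (exists u, strictly_positive (proj_along a \o b) A u) \/
    (exists2 c, semipositive A c & \sum_(i in A) c i *: proj_along a (b i) = 0) ->
  (exists2 u, pairing a u = 0 & strictly_positive b A u) \/
    (exists c (mu : R), semipositive A c /\ \sum_(i in A) c i *: b i = mu *: a).
Proof.
move=> a0 [[u uP]|[c c_semi cE]]; [left|right].
  exists (proj_along a u); first exact: proj_along_orth.
  by move=> i iA; rewrite -pairing_proj_along uP.
exists c, ((\sum_(i in A) c i * pairing (b i) a) / pairing a a); split=> //.
have aa0 : pairing a a != 0 by rewrite gt_eqF ?pairing_gt0.
apply: (scalerI aa0); rewrite scalerA [X in _ = X *: _]mulrC divfK //.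
apply/eqP; rewrite -subr_eq0 scaler_sumr [X in _ - X]scaler_suml -sumrB -[X in _ == X]cE.
apply/eqP/eq_bigr => i _.
by rewrite /proj_along scalerBr !scalerA (mulrC (pairing a a)).
Qed.

(** By induction on the number of vectors. Let [a] be one of them and project
    the others along [a]. A functional positive on the others and vanishing at
    [a] becomes positive at [a] too after a small multiple of [a] is added.
    Otherwise some combination of the others is [mu *: a]: it is a dependence
    when [mu <= 0], while for [mu > 0] the vector [a] lies in the cone of the
    others, and the alternative for the others settles the matter. *)
Lemma gordan b A :
  (exists u, strictly_positive b A u) \/
  (exists2 c, semipositive A c & \sum_(i in A) c i *: b i = 0).
Proof.
move: {2}#|A| (erefl #|A|) => m; elim: m A b => [|m IH] A b.
  by move/cards0_eq->; left; exists 0 => i; rewrite inE.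
move=> Am; have [i0 i0A] : exists i, i \in A by apply/card_gt0P; rewrite Am.
have A'm : #|(A :\ i0)%SET| = m.
  by move: Am; rewrite (cardsD1 i0) i0A => -[].
have A'P i : i \in (A :\ i0)%SET -> (i != i0) /\ (i \in A).
  by rewrite !inE => /andP.
have [a0|a0] := eqVneq (b i0) 0.
  right; exists (fun i => (i == i0)%:R); first split=> [i|].
  - by rewrite ler0n.
  - by exists i0 => //; rewrite eqxx.
  rewrite (big_setD1 i0) //= a0 scaler0 add0r big1 // => i /A'P [/negPf-> _].
  by rewrite scale0r.
have [[u ua u_pos]|[c [mu [[c0 [j jA' cj]] cE]]]] :=
    gordan_relative a0 (IH _ (proj_along (b i0) \o b) A'm).
  (* K is large enough for K * <b i, u> to outweigh <b i, b i0>, all i != i0. *)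
  left; pose K := 1 + \sum_(i in (A :\ i0)%SET)
    `|pairing (b i) (b i0)| / pairing (b i) u.
  exists (K *: u + b i0) => i iA; rewrite pairingDr pairingZr.
  have [->|ii0] := eqVneq i i0; first by rewrite ua mulr0 add0r pairing_gt0.
  have iA' : i \in (A :\ i0)%SET by rewrite !inE ii0.
  have ui := u_pos i iA'; rewrite -ltrBlDr sub0r.
  apply: (le_lt_trans (y := `|pairing (b i) (b i0)|)).
    by rewrite -normrN ler_norm.
  rewrite -ltr_pdivrMr // /K (big_setD1 i) //= addrCA ltrDl ltr_pwDl //.
  by apply: sumr_ge0 => k; rewrite !inE => /and3P[_ k0 kA];
     rewrite divr_ge0 // ltW // u_pos // !inE k0.
have [_ jA] := A'P j jA'.
have [mu0|mu0] := leP mu 0.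
  right; exists (fun i => if i == i0 then - mu else c i); first split=> [i|].
  - by case: ifP => // _; rewrite oppr_ge0.
  - by exists j => //; have [/negPf-> _] := A'P j jA'.
  rewrite (big_setD1 i0) //= eqxx.
  rewrite (eq_bigr (fun i => c i *: b i)) => [|i /A'P [/negPf-> _] //].
  by rewrite cE -scalerDl addNr scale0r.
have [[u u_pos]|[d [d0 [k kA' dk]] dE]] := IH _ b A'm; [left|right].
  exists u => i iA; have [->|ii0] := eqVneq i i0; last first.
    by apply: u_pos; rewrite !inE ii0.
  rewrite -(pmulr_rgt0 _ mu0) -pairingZl -cE pairing_suml.
  rewrite (big_setD1 j) //= ltr_pwDl //.
    by rewrite pairingZl mulr_gt0 // u_pos.
  apply: sumr_ge0 => k; rewrite inE => /andP[_ kA'].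
  by rewrite pairingZl mulr_ge0 // ltW // u_pos.
exists (fun i => if i == i0 then 0 else d i); first split=> [i|].
- by case: ifP.
- by have [/negPf k0 kA] := A'P k kA'; exists k; rewrite ?k0.
rewrite (big_setD1 i0) //= eqxx scale0r add0r.
by rewrite (eq_bigr (fun i => d i *: b i)) // => i /A'P [/negPf->].
Qed.

End Gordan.

(** * Strictly convex cones are generated by their rays *)

Section Cones.
Variables (R : realFieldType) (n : nat) (I : finType).
Implicit Types (b : I -> 'rV[R]_n) (A : {set I}).

Definition cone_of b A : set 'rV[R]_n :=
  [set x | exists2 c : I -> R,
     (forall i, 0 <= c i) & x = \sum_(i in A) c i *: b i].

Definition irredundant b A := forall i, i \in A -> ~ cone_of b (A :\ i)%SET (b i).

(** Dropping redundant generators one by one does not change the cone; a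
    generating subset that is minimal for inclusion cannot be shrunk further. *)
Lemma irredundant_generators b A :
  exists2 A0 : {set I}, irredundant b A0 & cone_of b A `<=` cone_of b A0.
Proof.
pose P (A' : {set I}) := `[< cone_of b A `<=` cone_of b A' >].
have PA : P A by apply/asboolP.
have [A0 /minsetP[/asboolP A0P A0min] _] := minset_exists PA.
exists A0 => // i iA0 [d d0 dE].
have : i \in (A0 :\ i)%SET; last by rewrite !inE eqxx.
rewrite (A0min (A0 :\ i)%SET) ?subsetDl //; apply/asboolP => x /A0P [c c0 ->].
exists (fun j => c j + c i * d j) => [j|]; first by rewrite addr_ge0 ?mulr_ge0.
rewrite (big_setD1 i) //= dE scaler_sumr -big_split /=.
by apply: eq_bigr => j _; rewrite scalerDl scalerA addrC.
Qed.

(** Apply Gordan's alternative to the other generators, modulo the line of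
    [b i]. If no functional exposes the ray of [b i], a semipositive combination
    of the others equals [mu *: b i]: for [mu > 0] the generator [b i] is
    redundant, and for [mu <= 0] the opposite of some [c j *: b j] is in the
    cone, so that [b j = 0] is redundant. *)
Lemma irredundant_exposed b A i :
  (forall x, cone_of b A x -> cone_of b A (- x) -> x = 0) ->
  irredundant b A -> i \in A ->
  exists2 u, pairing (b i) u = 0 & strictly_positive b (A :\ i)%SET u.
Proof.
move=> A_sc A_irr iA.
have b_neq0 j : j \in A -> b j != 0.
  move=> jA; apply/eqP => bj0; apply: (A_irr j jA).
  exists (fun=> 0) => //; rewrite bj0 big1 // => k _; exact: scale0r.
have [//|[c [mu [[c0 [j jA' cj]] cE]]]] :=
  gordan_relative (b_neq0 i iA) (gordan (proj_along (b i) \o b) (A :\ i)%SET).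
have /andP[ji jA] : (j != i) && (j \in A) by move: jA'; rewrite !inE.
exfalso; have [mu0|mu0] := leP mu 0; last first.
  apply: (A_irr i iA); exists (fun k => mu^-1 * c k) => [k|].
    by rewrite mulr_ge0 // invr_ge0 ltW.
  under eq_bigr do rewrite -scalerA.
  by rewrite -scaler_sumr cE scalerA mulVf ?scale1r ?gt_eqF.
have: c j *: b j = 0.
  apply: A_sc.
    exists (fun k => if k == j then c j else 0) => [k|]; first by case: ifP.
    rewrite (big_setD1 j) //= eqxx big1 ?addr0 // => k.
    by rewrite !inE => /andP[/negPf-> _]; rewrite scale0r.
  exists (fun k => if k == i then - mu else if k == j then 0 else c k) => [k|].
    by case: ifP => _; rewrite ?oppr_ge0 //; case: ifP.
  rewrite (big_setD1 i) //= eqxx scaleNr -cE [in RHS](big_setD1 j jA').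
  rewrite [X in _ + X](big_setD1 j jA') /= eqxx (negPf ji) scale0r add0r opprD.
  rewrite -addrA [X in _ + (_ + X)](eq_bigr (fun k => c k *: b k)) ?addNr ?addr0 // => k.
  by rewrite !inE => /and3P[/negPf-> /negPf-> _].
by move/eqP; rewrite scaler_eq0 (negPf (b_neq0 j jA)) gt_eqF.
Qed.

End Cones.

Lemma primitive_multiple (n : nat) (x : 'rV[int]_n) : x != 0 ->
  exists (w : 'rV[int]_n) (c : nat), [/\ primitive w, (0 < c)%N & x = w *+ c].
Proof.
move=> x0; pose g := \big[gcdn/0%N]_i `|x ord0 i|%N.
have g_dvd i : (g %| x ord0 i)%Z by rewrite dvdzE /= (biggcdn_inf i).
pose w := \row_i (x ord0 i %/ g)%Z.
have xE : x = w *+ g.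
  by apply/rowP => i; rewrite mulmxnE mxE pmulrn mulrzz divzK.
have g0 : (0 < g)%N.
  by rewrite lt0n; apply/eqP => g0; move: x0; rewrite xE g0 mulr0n eqxx.
exists w, g; split=> //; split.
  by apply/eqP => w0; move: x0; rewrite xE w0 mul0rn eqxx.
move=> d y wE; have : (g * d %| g)%N.
  apply/dvdn_biggcdP => i _; rewrite xE wE -mulrnA mulmxnE pmulrn mulrzz.
  by rewrite abszM /= mulnC dvdn_mull.
by rewrite -[X in (_ %| X)%N]muln1 dvdn_pmul2l // dvdn1 => /eqP.
Qed.

Lemma rayP (R : realType) (n : nat) (w : 'rV[int]_n) x :
  ray R w x <-> exists2 c : R, 0 <= c & x = c *: toR R w.
Proof.
split=> [[c [c0 ->]]|[c c0 ->]]; first by exists (c ord0); rewrite // big_ord1.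
by exists (fun=> c); split=> //; rewrite big_ord1.
Qed.

(** Each generator in an irredundant generating set of a strictly convex cone
    spans an exposed ray, hence a cone of the fan. *)
Lemma fan_cone_rays (R : realType) (n : nat) (Sigma : set (set 'rV[R]_n))
    (sigma : set 'rV[R]_n) (x : 'rV[R]_n) :
  complete_fan Sigma -> Sigma sigma -> sigma x ->
  exists (I : finType) (A : {set I}) (w : I -> 'rV[int]_n) (c : I -> R),
    [/\ forall i, i \in A -> rays Sigma (w i) /\ ray R (w i) `<=` sigma,
        forall i, 0 <= c i
      & x = \sum_(i in A) c i *: toR R (w i)].
Proof.
move=> [_ Sigma_cone Sigma_face _ _] Ss sx.
have [[s sE] s_sc] := Sigma_cone _ Ss.
pose b (i : 'I_(size s)) := toR R s`_i.
have [A A_irr A_gen] := irredundant_generators b [set: 'I_(size s)]%SET.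
have s_cone y : sigma y <-> cone_of b A y.
  split=> [|[c c0 ->]]; rewrite sE.
    by move=> [c [c0 ->]]; apply: A_gen; exists c => //; apply: eq_bigl => i; rewrite inE.
  exists (fun i => if i \in A then c i else 0); split=> [i|].
    by case: ifP.
  by rewrite big_mkcond; apply: eq_bigr => i _; case: ifP; rewrite ?scale0r.
have A_sc y : cone_of b A y -> cone_of b A (- y) -> y = 0.
  by move=> /s_cone + /s_cone; apply: s_sc.
have b_neq0 i : i \in A -> s`_i != 0.
  move=> iA; apply/eqP => si0; apply: (A_irr i iA); exists (fun=> 0) => //.
  rewrite big1 => [|k _]; last exact: scale0r.
  by apply/rowP => j; rewrite !mxE si0 mxE.
have /choice [wg wgP] (i : 'I_(size s)) : exists p : 'rV[int]_n * nat,
    i \in A -> [/\ primitive p.1, (0 < p.2)%N & s`_i = p.1 *+ p.2].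
  have [iA|_] := boolP (i \in A); last by exists (0, 0%N).
  by have [w [g ?]] := primitive_multiple (b_neq0 i iA); exists (w, g).
have bE i : i \in A -> b i = (wg i).2%:R *: toR R (wg i).1.
  by move=> /wgP[_ _ siE]; rewrite /b siE toRMn.
have ray_sub i : i \in A -> ray R (wg i).1 `<=` sigma.
  move=> iA y /rayP [c c0 ->]; apply/s_cone.
  exists (fun j => if j == i then c / (wg i).2%:R else 0) => [j|].
    by case: ifP => // _; rewrite divr_ge0.
  have [_ g0 _] := wgP i iA.
  rewrite (big_setD1 i) //= eqxx bE // scalerA divfK ?pnatr_eq0 -?lt0n //.
  rewrite big1 ?addr0 // => j.
  by rewrite !inE => /andP[/negPf-> _]; rewrite scale0r.
have [c c0 xE] : cone_of b A x by apply/s_cone.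
exists 'I_(size s), A, (fun i => (wg i).1), (fun i => c i * (wg i).2%:R).
split=> [i iA|i|]; last 1 first.
- by rewrite xE; apply: eq_bigr => i iA; rewrite bE // scalerA.
- split; last exact: ray_sub.
  have [w_prim g0 _] := wgP i iA; split=> //; apply: (Sigma_face sigma) => //.
  have [u ui u_pos] := irredundant_exposed A_sc A_irr iA.
  have pairing_u d :
      pairing (\sum_(j in A) d j *: b j) u =
      \sum_(j in (A :\ i)%SET) d j * pairing (b j) u.
    rewrite pairing_suml (big_setD1 i) //= pairingZl ui mulr0 add0r.
    by apply: eq_bigr => j _; rewrite pairingZl.
  have u_ge0 (d : 'I_(size s) -> R) j : (forall j, 0 <= d j) -> j \in (A :\ i)%SET ->
      0 <= d j * pairing (b j) u.
    by move=> d0 jA; rewrite mulr_ge0 // ltW // u_pos.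
  exists u; split=> [y /s_cone [d d0 ->]|].
    by rewrite pairing_u; apply: sumr_ge0 => j jA; apply: u_ge0.
  apply/seteqP; split=> y.
    move=> yr; split; first exact: (ray_sub i).
    move/rayP: yr => [d _ ->]; rewrite pairingZl.
    move/eqP: ui; rewrite bE // pairingZl mulf_eq0 pnatr_eq0 gtn_eqF //=.
    by move/eqP->; rewrite mulr0.
  move=> [/s_cone [d d0 ->]]; rewrite pairing_u => /psumr_eq0P d_eq0.
  apply/rayP; exists (d i * (wg i).2%:R); first by rewrite mulr_ge0.
  rewrite (big_setD1 i) //= bE // scalerA big1 ?addr0 // => j jA.
  have /eqP := d_eq0 (fun j => u_ge0 d j d0) j jA.
  by rewrite mulf_eq0 (gt_eqF (u_pos j jA)) orbF => /eqP->; rewrite scale0r.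
- by rewrite mulr_ge0.
Qed.

(** * The valuation and the Klyachko filtrations on one cone *)

Section Bundle.
Variables (k : fieldType) (E : vectType k) (R : realType) (n : nat).
Variables (v : E -> 'rV[R]_n -> \bar R) (Sigma : set (set 'rV[R]_n)).
Variable B : toric_vector_bundle E Sigma.
Hypotheses (v_val : finite_PL_valuation v) (Sigma_fan : complete_fan Sigma).
Hypothesis B_v : represents B v.

(** Let [e] be a nonzero vector and [P] the set of lines of the decomposition
    attached to [sigma] on which [e] has a nonzero component. Both [v e] on
    [sigma] and the steps of the filtrations that contain [e] depend only on the
    characters of these lines; the minimum of these characters is expressed by
    its universal property. *)
Lemma local_characters (sigma : set 'rV[R]_n) (e : E) :
  Sigma sigma -> e != 0 ->
  exists (r : nat) (u : 'I_r -> 'rV[int]_n) (P : pred 'I_r),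
    [/\ exists j, P j,
        forall x z, sigma x ->
          (z <= v e x)%E <->
          (forall j, P j -> (z <= (pairing x (toR R (u j)))%:E)%E)
      & forall w i, rays Sigma w -> ray R w `<=` sigma ->
          klyachko_filtration B w i e <->
          (forall j, P j -> i <= pairing w (u j))].
Proof.
move=> Ss e0; have [r [L [u [_ [L_direct L_full] LK Lv]]]] := B_v Ss.
have /memv_sumP [c cL eE] : e \in (\sum_(j < r) L j)%VS by rewrite L_full memvf.
exists r, u, (fun j => c j != 0); split.
- apply: contrapT => /forallNP c0; move: e0; rewrite eE big1 ?eqxx // => j _.
  by apply/eqP/negP => /negP /c0.
- move=> x z sx; rewrite {1}eE Lv -?eE // => [|j]; last exact: cL.
  split=> [/bigmin_geP[_ //]|zP]; apply/bigmin_geP; split=> //.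
  by rewrite leey.
- move=> w i w_ray w_sub; rewrite LK //; split=> [|iP] /=.
    (* The components of e are unique, so they are those of e in the subsum. *)
    move=> /memv_sumP [d dL eE'] j; apply: contraNT; rewrite -ltNge => ji.
    pose d' j := if i <= pairing w (u j) then d j else 0.
    have /eqP : \sum_j c j = \sum_j d' j by rewrite -eE eE' big_mkcond.
    rewrite (directv_sum_unique L_direct) // => [/forallP/(_ j)/eqP ->|l _].
      by rewrite /d' leNgt ji.
    by rewrite /d'; case: ifP => [/dL//|_]; exact: mem0v.
  rewrite eE (bigID (fun j => i <= pairing w (u j))) /=.
  rewrite [X in _ + X]big1 ?addr0 => [|j ji].
    by apply: memv_sumr => j _; exact: cL.
  by apply/eqP; apply: contraNT ji; exact: iP.
Qed.

Lemma ray_generator (w : 'rV[int]_n) (c : nat) : ray R w (toR R (w *+ c)).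
Proof. by apply/rayP; exists c%:R; rewrite ?toRMn. Qed.

Lemma valuation0 x : v 0 x = +oo%E.
Proof. by have [_ _ _ v0 _] := v_val; rewrite (v0 0).2. Qed.

Lemma klyachko_filtration0 w i : rays Sigma w -> klyachko_filtration B w i 0.
Proof.
move=> w_ray; have [r [L [u [_ _ LK _]]]] := B_v w_ray.2.
by rewrite LK //= mem0v.
Qed.

Lemma klyachko_filtration_multiple w i e (c : nat) :
  rays Sigma w -> klyachko_filtration B w i e ->
  ((c%:Z * i)%:~R%:E <= v e (toR R (w *+ c)))%E.
Proof.
move=> w_ray; have [->|e0] := eqVneq e 0; first by rewrite valuation0 leey.
have [r [u [P [_ vP KP]]]] := local_characters w_ray.2 e0.
move=> /KP iP; apply/vP => [|j /iP ij]; first exact: ray_generator.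
rewrite lee_fin toRMn pairingZl pairing_toR intrM.
by rewrite ler_wpM2l ?ler0n // ler_int; apply: ij.
Qed.

Lemma klyachko_filtrationP w i e : rays Sigma w ->
  klyachko_filtration B w i e <-> (i%:~R%:E <= v e (toR R w))%E.
Proof.
move=> w_ray; split=> [/(klyachko_filtration_multiple 1 w_ray)|].
  by rewrite mul1r mulr1n.
have [->|e0] := eqVneq e 0; first by move=> _; exact: klyachko_filtration0.
have [r [u [P [_ vP KP]]]] := local_characters w_ray.2 e0.
move=> /vP iP; apply/KP => // j /iP.
rewrite pairing_toR lee_fin ler_int; apply.
by rewrite -[w]mulr1n; apply: ray_generator.
Qed.

Lemma klyachko_maxE w e : rays Sigma w -> e != 0 ->
  klyachko_max B w e = v e (toR R w).
Proof.
move=> w_ray e0; apply/eqP; rewrite eq_le; apply/andP; split.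
  by apply: ge_ereal_sup => _ [i /klyachko_filtrationP iK <-]; exact: iK.
have [r [u [P [[j0 Pj0] vP KP]]]] := local_characters w_ray.2 e0.
have [j Pj jmin] := arg_minP (fun j => pairing w (u j)) Pj0.
have w_in : ray R w (toR R w) by rewrite -[w]mulr1n; apply: ray_generator.
apply: (@le_trans _ _ (pairing w (u j))%:~R%:E).
  by rewrite -pairing_toR; apply: (vP _ _ w_in).1 Pj.
by apply: ereal_sup_ubound; exists (pairing w (u j)) => //; apply/KP.
Qed.

(** * The arrangements *)

Lemma phi_max_leP (F : seq ('rV[int]_n * int)) (x : 'rV[int]_n) (z : \bar R) :
  (er_map (fun m : int => m%:~R : R) (phi_max F x) <= z)%E <->
  (forall p, p \in F -> (er_map (fun m : int => m%:~R) (phi_ray p.1 p.2 x) <= z)%E).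
Proof.
have er_max (a b : \bar int) :
    er_map (fun m : int => m%:~R : R) (Order.max a b) =
    Order.max (er_map (fun m : int => m%:~R) a) (er_map (fun m : int => m%:~R) b).
  case: a b => [a| |] [b| |]; rewrite ?maxey ?maxye ?maxeNy ?maxNye //=.
  by rewrite !maxEle !lee_fin ler_int; case: ifP.
rewrite /phi_max; elim: F => [|p F IH]; first by rewrite big_nil leNye.
rewrite big_cons er_max ge_max; split=> [/andP[pz /IH Fz] q|Fz].
  by rewrite inE => /orP[/eqP->|/Fz].
rewrite Fz ?mem_head //=; apply/IH => q qF; apply: Fz.
by rewrite inE qF orbT.
Qed.

(** Off its ray, [phi_ray] is -oo and imposes nothing; on the ray, the conditions
    at all multiples of [w] follow from the one at [w] itself. *)
Lemma E_ge_phi_max (F : seq ('rV[int]_n * int)) :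
  (forall p, p \in F -> rays Sigma p.1) ->
  E_ge v (phi_max F) =
    [set e | forall p, p \in F -> klyachko_filtration B p.1 p.2 e].
Proof.
move=> F_rays; apply/seteqP; split=> e /= eP.
  move=> p pF; have p_ray := F_rays p pF; have [[w0 _] _] := p_ray.
  apply/klyachko_filtrationP => //; move/phi_max_leP: (eP p.1) => /(_ p pF).
  by rewrite -{2}[p.1]mulr1n phi_rayE //= mul1r.
move=> x; apply/phi_max_leP => p pF.
have p_ray := F_rays p pF; have [[w0 _] _] := p_ray.
have [[c ->]|x_off] := pselect (exists c : nat, x = p.1 *+ c).
  by rewrite phi_rayE //=; apply: klyachko_filtration_multiple => //; exact: eP.
by rewrite /phi_ray; case: pselect => // _; rewrite leNye.
Qed.

Lemma arrangement_S_fan : arrangement v (S_fan Sigma) = klyachko_arrangement B.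
Proof.
apply/seteqP; split=> U.
  by move=> [_ [F [F0 F_rays ->]] UE]; exists F; split; rewrite // UE E_ge_phi_max.
move=> [F [F0 F_rays UE]]; exists (phi_max F); first by exists F.
by rewrite UE E_ge_phi_max.
Qed.

(** * The polytopes *)

(** The polytope of [v e] is cut out by the points of the rays alone: on a cone
    [v e] is a minimum of linear functions, hence concave, so that its values are
    bounded below by those of its restriction to the rays. *)
Lemma DJS_polytopeE e : e != 0 -> DJS_polytope B e = polytope (v e).
Proof.
move=> e0; apply/seteqP; split=> y /= yP; last first.
  by move=> w w_ray; rewrite klyachko_maxE.
move=> x; have [_ _ _ _ Sigma_complete] := Sigma_fan.
have [sigma Ss sx] := Sigma_complete x.
have [I [A [w [c [wP c0 xE]]]]] := fan_cone_rays Sigma_fan Ss sx.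
have [r [u [P [_ vP _]]]] := local_characters Ss e0.
apply/vP => // j Pj; rewrite lee_fin xE !pairing_suml.
apply: ler_sum => i iA; have [w_ray w_sub] := wP i iA.
rewrite !pairingZl ler_wpM2l // -lee_fin.
have := yP _ w_ray; rewrite klyachko_maxE // => /vP; apply=> //.
by apply: w_sub; rewrite -[w i]mulr1n; apply: ray_generator.
Qed.

End Bundle.

Lemma ground_set_neq0 (k : fieldType) (E : vectType k) (A : set {vspace E})
    (gens : seq E) (e : E) :
  generic_ground_set A gens -> e \in gens -> e != 0.
Proof.
move=> [_ [b [b_basis gensP _]]] /gensP [U U_indec].
exact/free_not0/basis_free/b_basis.
Qed.

Theorem proposition3p15 (k : fieldType) (k_char0 : [pchar k] =i pred0)
    (E : vectType k) (R : realType) (n : nat)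
    (v : E -> 'rV[R]_n -> \bar R) (v_val : finite_PL_valuation v)
    (Sigma : set (set 'rV[R]_n)) (Sigma_fan : complete_fan Sigma)
    (B : toric_vector_bundle E Sigma) (B_v : represents B v) :
  arrangement v (S_fan Sigma) = klyachko_arrangement B /\
  forall M : set {vspace E} -> seq E,
    generic_ground_set (arrangement v (S_fan Sigma))
      (M (arrangement v (S_fan Sigma))) ->
    generic_ground_set (klyachko_arrangement B)
      (M (klyachko_arrangement B)) ->
    perm_eq (DJS_parliament M B) (parliament M v (S_fan Sigma)).
Proof.
have arrE := arrangement_S_fan v_val B_v.
split=> // M _ M_gen; rewrite /DJS_parliament /parliament arrE.
suff -> : [seq DJS_polytope B e | e <- M (klyachko_arrangement B)] =
          [seq polytope (v e) | e <- M (klyachko_arrangement B)] by [].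
apply/eq_in_map => e eM; apply: (DJS_polytopeE v_val) => //.
exact: ground_set_neq0 M_gen eM.
Qed.
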